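(* For the Chaplygin sphere, the angular momentum with respect to the vertical axis, $K_3^s=\mathbf K^b\cdot\gamma$, is a Casimir function of the reduced affine nonholonomic bracket $\{\cdot,\cdot\tilde{\}}_{\mathcal{R}}$, i.e. $\{F,\mathbf K^b\cdot\gamma\tilde{\}}_{\mathcal{R}}=0$ for all $F\in C^\infty(\mathcal{R})$.
   Context: Chaplygin sphere and its reduced affine bracket: an inhomogeneous sphere of mass $m>0$, radius $r>0$ and inertia tensor $\mathbb{I}=\mathrm{diag}(I_1,I_2,I_3)$, $I_i>0$, rolls without slipping on a plane. Its configuration space is $Q=SO(3)\times\mathbb{R}^2\ni(g;(x,y))$, with Lagrangian $\mathcal{L}=\frac12(\mathbb{I}\omega^b)\cdot\omega^b+\frac12m(v_x^2+v_y^2)$ and constraints $v_x=r\omega^s_2$, $v_y=-r\omega^s_1$, where $\hat\omega^b=g^{-1}\dot g$, $\omega^s=g\omega^b$ (hat map $\hat{\mathbf v}\mathbf w=\mathbf v\times\mathbf w$). $\mathcal{M}\subset T^*Q$ is the image of the constraint distribution under the Legendre transform, and $\mathcal{C}\subset T\mathcal{M}$ is the distribution of vectors whose projection to $TQ$ satisfies the constraints. Let $\tilde\Omega_Q=\Omega_Q-mr^2\,\mathbf{i}_{X_{\mathcal{H}}}\bar\nu$, with $\Omega_Q=dq_a\wedge dp_a$ the canonical symplectic form, $X_{\mathcal{H}}$ the Hamiltonian vector field ($\mathbf{i}_{X_{\mathcal{H}}}\Omega_Q=d\mathcal{H}$) of the kinetic energy $\mathcal{H}$ on $T^*Q$, and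 $\bar\nu$ the pull-back to $T^*Q$ of the bi-invariant volume form $\nu$ on $SO(3)$ normalized by $\nu(e_1,e_2,e_3)=1$. With $\tilde{\mathcal{P}}$ the projector onto $\mathcal{C}$ along its $\tilde\Omega_Q$-orthogonal complement, the affine nonholonomic bracket on $\mathcal{M}$ is $\{f_1,f_2\tilde{\}}_{\mathcal{M}}=\tilde\Omega_Q(\tilde{\mathcal{P}}\tilde X_{\bar f_1},\tilde{\mathcal{P}}\tilde X_{\bar f_2})$, where $\bar f_i$ are arbitrary extensions of $f_i$ to $T^*Q$ and $\mathbf{i}_{\tilde X_{\bar f}}\tilde\Omega_Q=d\bar f$. It is invariant under the cotangent lift of the $SE(2)$ action $(h;a,b):(g;(x,y))\mapsto(hg;(x,y)\tilde h^t+(a,b))$, with $h=\begin{pmatrix}\tilde h&0\\0&1\end{pmatrix}$, $\tilde h\in SO(2)$, and it induces $\{\cdot,\cdot\tilde{\}}_{\mathcal{R}}$ on $\mathcal{R}=\mathcal{M}/SE(2)$ by $\{F_1,F_2\tilde{\}}_{\mathcal{R}}\circ\pi=\{F_1\circ\pi,F_2\circ\pi\tilde{\}}_{\mathcal{M}}$, $\pi$ the orbit projection. Explicit description: $\mathcal{R}$ is identified with $\{(\mathbf K^b,\gamma)\in\mathbb{R}^3\times\mathbb{R}^3:\|\gamma\|=1\}\cong\mathbb{R}^3\times S^2$, where $\gamma=g^{-1}e_3$ and $\mathbf K^b=\mathbb{I}\omega^b+mr^2(\omega^b-(\omega^b\cdot\gamma)\gamma)$ is the angular momentum about the contact point in body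 coordinates ($\mathbf K^s=g\mathbf K^b$ in space coordinates), and the bracket $\{\cdot,\cdot\tilde{\}}_{\mathcal{R}}$ is the (bilinear, skew-symmetric, Leibniz) bracket determined by $$\{K^b_i,K^b_j\tilde{\}}_{\mathcal{R}}=-c_{ijl}\bigl(K^b_l-mr^2\omega^s_3\gamma_l\bigr),\quad\{K^b_i,\gamma_j\tilde{\}}_{\mathcal{R}}=-c_{ijl}\gamma_l,\quad\{\gamma_i,\gamma_j\tilde{\}}_{\mathcal{R}}=0,$$ where $c_{ijl}$ is the Levi-Civita symbol and $\omega^s_3=\frac{\mathbf K^b\cdot A^{-1}\gamma}{Y(\gamma)}$ with $A=\mathbb{I}+mr^2E$ ($E$ the identity matrix), $Y(\gamma)=1-mr^2(\gamma\cdot A^{-1}\gamma)>0$. ($\|\gamma\|^2$ is a Casimir, so these formulas define a bracket on $\mathcal{R}$.) *)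

(* Defs.v *)
From HB Require Import structures.
From mathcomp Require Import all_boot all_order all_algebra.
From mathcomp Require Import all_classical all_reals all_analysis.

Set Implicit Arguments.
Unset Strict Implicit.
Unset Printing Implicit Defensive.

Import Order.TTheory GRing.Theory Num.Theory.
Import numFieldNormedType.Exports.

Local Open Scope ring_scope.

Definition dot (R : realType) (u v : 'cV[R]_3) : R := \sum_(i < 3) u i 0 * v i 0.

(* The indices run over {0, 1, 2}. *)
Definition levi_civita (R : realType) (i j l : 'I_3) : R :=
  ((j%:R - i%:R) * (l%:R - i%:R) * (l%:R - j%:R)) / 2%:R.

(* Pairs (K^b, gamma) with gamma a Euclidean unit vector; the library norm on
   matrices is the sup norm, whence the dot product. *)
Definition reduced_space (R : realType) : Type :=
  {p : 'cV[R]_3 * 'cV[R]_3 | dot p.2 p.2 == 1}.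

Fixpoint class_C (R : realType) (V : normedModType R) (k : nat) (f : V -> R) : Prop :=
  match k with
  | 0 => continuous f
  | k'.+1 => (forall x, differentiable f x) /\ (forall v, class_C k' ('D_v f))
  end.

(* For finite-dimensional V, the only case used, this is the usual notion. *)
Definition smooth (R : realType) (V : normedModType R) (f : V -> R) : Prop :=
  forall k, class_C k f.

(* R^3 x S^2 is a closed embedded submanifold of R^3 x R^3, so its smooth
   functions are exactly the restrictions of smooth functions on R^3 x R^3. *)
Definition smooth_red (R : realType) (F : reduced_space R -> R) : Prop :=
  exists2 G : 'cV[R]_3 * 'cV[R]_3 -> R, smooth G & forall p, F p = G (val p).

Definition Kb (R : realType) (i : 'I_3) (p : reduced_space R) : R := (val p).1 i 0.

Definition gam (R : realType) (i : 'I_3) (p : reduced_space R) : R := (val p).2 i 0.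

Definition K3s (R : realType) (p : reduced_space R) : R := dot (val p).1 (val p).2.

(* A = diag(I_1, I_2, I_3) + m r^2 E *)
Definition Amx (R : realType) (I : 'rV[R]_3) (m r : R) : 'M[R]_3 :=
  diag_mx I + (m * r ^+ 2)%:M.

Definition Yfun (R : realType) (I : 'rV[R]_3) (m r : R) (gamma : 'cV[R]_3) : R :=
  1 - m * r ^+ 2 * dot gamma (invmx (Amx I m r) *m gamma).

Definition omega3s (R : realType) (I : 'rV[R]_3) (m r : R)
    (p : reduced_space R) : R :=
  dot (val p).1 (invmx (Amx I m r) *m (val p).2) / Yfun I m r (val p).2.

(* Brackets on C^oo(R^3 x S^2): [br] is only constrained on smooth functions. *)
Record is_bracket (R : realType)
    (br : (reduced_space R -> R) -> (reduced_space R -> R) -> reduced_space R -> R)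
    : Prop := IsBracket {
  br_smooth : forall F G, smooth_red F -> smooth_red G -> smooth_red (br F G);
  br_linearl : forall (a b : R) F G H,
    smooth_red F -> smooth_red G -> smooth_red H ->
    forall p, br (fun q => a * F q + b * G q) H p = a * br F H p + b * br G H p;
  br_linearr : forall (a b : R) F G H,
    smooth_red F -> smooth_red G -> smooth_red H ->
    forall p, br H (fun q => a * F q + b * G q) p = a * br H F p + b * br H G p;
  br_skew : forall F G, smooth_red F -> smooth_red G ->
    forall p, br F G p = - br G F p;
  br_leibniz : forall F G H, smooth_red F -> smooth_red G -> smooth_red H ->
    forall p, br (fun q => F q * G q) H p = F p * br G H p + br F H p * G p }.

Record is_reduced_affine_bracket (R : realType) (I : 'rV[R]_3) (m r : R)
    (br : (reduced_space R -> R) -> (reduced_space R -> R) -> reduced_space R -> R)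
    : Prop := IsReducedAffineBracket {
  rab_bracket : is_bracket br;
  rab_KK : forall (i j : 'I_3) p,
    br (Kb i) (Kb j) p =
      - \sum_(l < 3) levi_civita R i j l *
          (Kb l p - m * r ^+ 2 * omega3s I m r p * gam l p);
  rab_Kgam : forall (i j : 'I_3) p,
    br (Kb i) (gam j) p = - \sum_(l < 3) levi_civita R i j l * gam l p;
  rab_gamgam : forall (i j : 'I_3) p, br (gam i) (gam j) p = 0 }.

Definition is_casimir (R : realType)
    (br : (reduced_space R -> R) -> (reduced_space R -> R) -> reduced_space R -> R)
    (C : reduced_space R -> R) : Prop :=
  smooth_red C /\ forall F, smooth_red F -> forall p, br F C p = 0.

(* Main.v *)
Require Import Defs.
From HB Require Import structures.
From mathcomp Require Import all_boot all_order all_algebra.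
From mathcomp Require Import all_classical all_reals all_analysis.
From mathcomp Require Import ring lra.

Import Order.TTheory GRing.Theory Num.Theory.
Import numFieldNormedType.Exports.
Local Open Scope ring_scope.
Local Open Scope classical_set_scope.

(** Why the vertical angular momentum [K3s = \sum_j Kb j * gam j] is a Casimir.

    On the coordinate functions this is a symmetry argument. By the Leibniz
    rule, the bracket of [Kb i] or [gam i] with [K3s] is, up to sign, a double
    sum [\sum_j \sum_l levi_civita R i j l * S j l] in which [S] is symmetric:
    for [gam i] it is made of the products [gam j * gam l]; for [Kb i] it is made
    of [Kb j * gam l + Kb l * gam j], one half from each factor of [K3s], and of
    the affine term, which is again a multiple of [gam j * gam l]. Such sums
    vanish by antisymmetry ([levi_civita_sum_sym]).

    It remains to pass from the coordinates to an arbitrary smooth [F]. At a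
    fixed point [p], [F |-> br F K3s p] is a derivation, so the point is that a
    derivation at [p] is determined by its values on the coordinates
    ([derivation_eq0]). This follows from Hadamard's lemma ([hadamard]): a smooth
    [f] is [f p + \sum_i c i (x - p) * g i x] with smooth [g i], and applying the
    derivation leaves only terms containing either the derivation of a
    coordinate or the factor [c i (p - p) = 0].

    In Hadamard's lemma [g i x] is the integral over [0, 1] of
    ['D_(e i) f (p + t *: (x - p))], and the work is in its smoothness. The means
    [\int t^k f(p + t (x - p)) dt] form a family stable under differentiation:
    the derivative along [v] is the mean of index [k + 1] of ['D_v f]. Hence they
    are as smooth as [f] by induction ([class_C_radial_mean]), once
    differentiation under the integral sign is available for differentiability
    in the sense of Frechet ([leibniz_int01]); the latter rests on the mean value
    theorem and the compactness of [0, 1]. *)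

(** * Integrals of continuous functions over the unit interval *)

Definition int01 {R : realType} (f : R -> R) : R :=
  \int[lebesgue_measure]_(t in `[0, 1]) f t.

Lemma continuous_cstM {R : realType} {T : topologicalType} (a : R) (f : T -> R) :
  continuous f -> continuous (fun t => a * f t).
Proof. by move=> fc t; apply: cvgM; [exact: cvg_cst|exact: fc]. Qed.

Lemma continuous_add {R : realType} {T : topologicalType} (f g : T -> R) :
  continuous f -> continuous g -> continuous (fun t => f t + g t).
Proof. by move=> fc gc t; apply: cvgD; [exact: fc|exact: gc]. Qed.

Lemma section_continuous {S T U : topologicalType} (F : S -> T -> U) (y : T) :
  continuous (fun z : S * T => F z.1 z.2) -> continuous (F ^~ y).
Proof.
move=> Fc s.
apply: (@continuous_comp _ _ _ (fun s => (s, y)) (fun z => F z.1 z.2)); last exact: Fc.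
by apply: (cvg_pair (G := nbhs s) (H := nbhs y)); [exact: cvg_id|exact: cvg_cst].
Qed.

Lemma integrable01 {R : realType} (f : R -> R) : continuous f ->
  (@lebesgue_measure R).-integrable `[0, 1] (EFin \o f).
Proof.
move=> fc; apply: continuous_compact_integrable; first exact: segment_compact.
exact: continuous_subspaceT.
Qed.

Lemma int01D {R : realType} (f g : R -> R) : continuous f -> continuous g ->
  int01 (fun t => f t + g t) = int01 f + int01 g.
Proof.
by move=> fc gc; rewrite /int01 RintegralD//; exact: integrable01.
Qed.

Lemma int01Z {R : realType} (f : R -> R) (a : R) : continuous f ->
  int01 (fun t => a * f t) = a * int01 f.
Proof. by move=> fc; rewrite /int01 RintegralZl//; exact: integrable01. Qed.

Lemma int01_le {R : realType} (f : R -> R) (M : R) : continuous f ->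
  (forall t, t \in `[0, 1]%R -> `|f t| <= M) -> `|int01 f| <= M.
Proof.
move=> fc fM; rewrite /int01.
apply: le_trans (le_normr_Rintegral _ _) _ => //; first exact: integrable01.
have -> : M = \int[lebesgue_measure]_(t in (`[0, 1] : set R)) M.
  by rewrite Rintegral_cst//= lebesgue_measure_itv/= lte_fin ltr01 oppr0 adde0 mulr1.
apply: le_Rintegral => //.
- apply: (integrable01 (fun t => `|f t|)) => t.
  by apply: continuous_comp; [exact: fc|exact: norm_continuous].
- by apply: (integrable01 (cst M)) => t; exact: cst_continuous.
Qed.

Lemma int01_derivative {R : realType} (f g : R -> R) : continuous g ->
  (forall t : R, is_derive t 1 f (g t)) -> int01 g = f 1 - f 0.
Proof.
move=> gc fg; have fc : continuous f.
  move=> t; apply: differentiable_continuous; apply/derivable1_diffP.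
  exact: ex_derive.
rewrite /int01 /Rintegral (@continuous_FTC2 _ g f)//.
- exact: continuous_subspaceT.
- split; first by move=> t _; exact: ex_derive.
  + exact/cvg_at_right_filter/fc.
  + exact/cvg_at_left_filter/fc.
- by move=> t _; rewrite derive1E; exact: derive_val.
Qed.

(** * Integrals depending on a parameter *)

(** Compactness of the unit interval makes continuity in the parameter uniform
    in [t]. *)
Lemma joint_continuous_unif {R : realType} {V : normedModType R}
    (F : R -> V -> R) (x : V) (eps : R) : continuous (fun z : R * V => F z.1 z.2) ->
  0 < eps -> \forall y \near x, forall t, t \in `[0, 1]%R -> `|F t y - F t x| <= eps.
Proof.
move=> Fc e0.
have := @segment_compact R 0 1; move/compact_near_coveringP.
move=> /(_ V (nbhs x) (fun y t => `|F t y - F t x| <= eps) _).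
apply => t0 _.
have e20 : 0 < eps / 2 by rewrite divr_gt0.
have /cvgrPdist_lt/(_ _ e20)[[A B] /= [At Bx] AB] := Fc (t0, x).
exists (A, B) => //= -[t y] [/= At1 By].
have h1 := AB (t, y) (conj At1 By).
have h2 := AB (t, x) (conj At1 (nbhs_singleton Bx)).
rewrite /= in h1 h2.
have -> : F t y - F t x = (F t0 x - F t x) - (F t0 x - F t y) by ring.
by rewrite (le_trans (ler_normB _ _))// [leRHS]splitr ltW// ltrD.
Qed.

Lemma continuous_int01 {R : realType} {V : normedModType R}
    (F : R -> V -> R) : continuous (fun z : R * V => F z.1 z.2) ->
  continuous (fun x => int01 (F ^~ x)).
Proof.
move=> Fc x.
have Fx y : continuous (F ^~ y) by exact: section_continuous.
apply/cvgrPdist_le => e e0; near=> y.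
have -> : int01 (F ^~ x) - int01 (F ^~ y) = int01 (fun t => F t x + -1 * F t y).
  by rewrite int01D// ?int01Z ?mulN1r//; exact: continuous_cstM.
apply: int01_le; first by apply: continuous_add => //; exact: continuous_cstM.
move=> t t01; rewrite mulN1r distrC; move: t t01; near: y.
exact: joint_continuous_unif.
Unshelve. all: by end_near. Qed.

Lemma is_derive_line {R : realType} {V : normedModType R} (f : V -> R) (x h : V) (s : R) :
  differentiable f (x + s *: h) ->
  is_derive s 1 (fun s : R => f (x + s *: h)) ('D_h f (x + s *: h)).
Proof.
move=> fd.
have ld : is_diff s (fun s : R => x + s *: h) (fun s => s *: h).
  by apply: is_diff_eq; rewrite add0r.
apply: DeriveDef.
  by apply/derivable1_diffP/(differentiable_comp (f := fun s : R => x + s *: h) (g := f)).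
rewrite deriveE; last by apply/(differentiable_comp (f := fun s : R => x + s *: h) (g := f)).
rewrite (diff_comp (f := fun s : R => x + s *: h) (g := f))//= deriveE//.
by rewrite [X in 'd f _ (X 1)]diff_val scale1r.
Qed.

Lemma derive_coord {R : realType} {V : normedModType R} {I : finType}
    (e : I -> V) (c : I -> {linear V -> R})
    (ec : forall v, v = \sum_i c i v *: e i) (f : V -> R) (x h : V) :
  differentiable f x -> 'D_h f x = \sum_i c i h * 'D_(e i) f x.
Proof.
move=> fd; rewrite deriveE// {1}(ec h) linear_sum; apply: eq_bigr => i _.
by rewrite linearZ/= deriveE.
Qed.

(** Differentiation under the integral sign. The finite frame [e] with
    coordinates [c] expresses that [V] is finite-dimensional: it reduces the
    remainder [F t (x + h) - F t x - 'D_h (F t) x], uniformly small compared with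
    [h], to the variation of finitely many partial derivatives. *)
Lemma leibniz_int01 {R : realType} {V : normedModType R} {I : finType}
    (e : I -> V) (c : I -> {linear V -> R}) (cc : forall i, continuous (c i))
    (ec : forall v, v = \sum_i c i v *: e i) (F : R -> V -> R) :
  continuous (fun z : R * V => F z.1 z.2) ->
  (forall t x, differentiable (F t) x) ->
  (forall v, continuous (fun z : R * V => 'D_v (F z.1) z.2)) ->
  forall x, differentiable (fun y => int01 (F ^~ y)) x /\
    forall v, 'D_v (fun y => int01 (F ^~ y)) x = int01 (fun t => 'D_v (F t) x).
Proof.
move=> Fc Fd dFc x; set J := (fun y => int01 (F ^~ y)).
have Fx y : continuous (F ^~ y) by exact: section_continuous.
have dFx v y : continuous (fun t => 'D_v (F t) y).
  exact: (section_continuous (fun t y => 'D_v (F t) y)).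
pose L h := int01 (fun t => 'D_h (F t) x).
have Llin : linear L.
  move=> a u v; rewrite /L.
  rewrite (_ : (fun t => _) = fun t => a * 'D_u (F t) x + 'D_v (F t) x).
    by rewrite int01D ?int01Z//; exact: continuous_cstM.
  by apply/funext => t; rewrite !deriveE// linearP.
pose LM := GRing.isLinear.Build _ _ _ _ _ Llin.
pose LL : {linear V -> R} := HB.pack L LM.
have Lc : continuous LL.
  have -> : (LL : V -> R) = fun h => \sum_i L (e i) * c i h.
    apply/funext => h; rewrite {1}(ec h) linear_sum; apply: eq_bigr => i _.
    by rewrite linearZ/= mulrC.
  by apply: continuous_big => [|i _]; [exact: add_continuous|exact: continuous_cstM].
have Jo : J \o shift x = cst (J x) + LL +o_ 0 id.
  have /choice[k kP] i : exists k, 0 < k /\ forall h, `|c i h| <= k * `|h|.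
    by have [k k0 kP] := linear_lipschitz (cc i); exists k.
  pose K := \sum_i k i.
  have K0 : 0 <= K by apply: sumr_ge0 => i _; rewrite ltW// (kP i).1.
  apply/eqaddoP => eps e0.
  (* The remainder is at most K * `|h| times the variation of the partials;
     1 + K rather than K avoids a division by zero. *)
  have d0 : 0 < eps / (1 + K) by rewrite divr_gt0// ltr_wpDr.
  have unif : \forall y \near x, forall i t, t \in `[0, 1]%R ->
      `|'D_(e i) (F t) y - 'D_(e i) (F t) x| <= eps / (1 + K).
    apply: filter_forall => i.
    exact: (joint_continuous_unif (fun t y => 'D_(e i) (F t) y)).
  have [r /= r0 xr] := (nbhs_ballP _ _).1 unif.
  near=> h.
  have hr : `|h| < r.
    by near: h; apply/nbhs_norm0P; exists r.
  rewrite /= -[(_ - _) h]/(J (h + x) - (J x + L h)).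
  have -> : J (h + x) - (J x + L h) =
      int01 (fun t => F t (h + x) + -1 * (F t x + 'D_h (F t) x)).
    by rewrite int01D ?int01Z ?int01D ?mulN1r//;
      [apply: continuous_add|apply: continuous_cstM; apply: continuous_add].
  apply: int01_le.
    by apply: continuous_add => //; apply: continuous_cstM; apply: continuous_add.
  move=> t t01.
  have [s s01 sE] : exists2 s, s \in `[0, 1]%R &
      F t (x + 1 *: h) - F t (x + 0 *: h) = 'D_h (F t) (x + s *: h) * (1 - 0).
    apply: (MVT_segment (f := fun s => F t (x + s *: h))
      (df := fun s => 'D_h (F t) (x + s *: h))) => //.
      by move=> s _; exact: is_derive_line.
    apply: continuous_subspaceT => s; apply: differentiable_continuous.
    by apply/derivable1_diffP/ex_derive; exact: is_derive_line.
  have xs : ball x r (x + s *: h).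
    rewrite -ball_normE /= opprD addNKr normrN normrZ.
    move: s01; rewrite in_itv /= => /andP[s0 s1].
    by rewrite ger0_norm// (le_lt_trans _ hr)// ler_piMl.
  have {}xs := xr _ xs.
  rewrite mulN1r opprD addrA (addrC h).
  move: sE; rewrite scale1r scale0r addr0 subr0 mulr1 => ->.
  rewrite !(derive_coord _ _ ec)// -sumrB.
  apply: le_trans (ler_norm_sum _ _ _) _.
  apply: (@le_trans _ _ (\sum_i (k i * `|h|) * (eps / (1 + K)))).
    apply: ler_sum => i _; rewrite -mulrBr normrM ler_pM//; first exact: (kP i).2.
    exact: xs.
  rewrite -mulr_suml -mulr_suml -/K.
  rewrite mulrACA (mulrC K) mulrACA.
  rewrite ler_piMr// ?mulr_ge0// ?(ltW e0)//.
  by rewrite ler_pdivrMr ?ltr_wpDr// mul1r lerDr.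
have dJ : 'd J x = LL :> (V -> R) by exact: diff_unique.
have Jd : differentiable J x by apply/diff_locallyP; rewrite dJ.
by split=> // v; rewrite deriveE// dJ.
Unshelve. all: by end_near. Qed.

(** * Functions of class C^k *)

Lemma class_C_continuous {R : realType} {V : normedModType R} n (f : V -> R) :
  class_C n f -> continuous f.
Proof.
by case: n => [//|n] [fd _] x; exact: differentiable_continuous.
Qed.

Lemma class_CW {R : realType} {V : normedModType R} n (f : V -> R) :
  class_C n.+1 f -> class_C n f.
Proof.
elim: n f => [|n IHn] f fC; first exact: class_C_continuous fC.
by have [fd dfC] := fC; split=> // v; exact/IHn/dfC.
Qed.

Lemma class_C_cst {R : realType} {V : normedModType R} n (a : R) :
  class_C n (fun _ : V => a).
Proof.
elim: n a => [|n IHn] a; first exact: cst_continuous.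
split=> [x|v]; first exact: differentiable_cst.
by rewrite (_ : 'D_v _ = fun=> 0); [exact: IHn|apply/funext => x; exact: derive_cst].
Qed.

Lemma class_C_add {R : realType} {V : normedModType R} n (f g : V -> R) :
  class_C n f -> class_C n g -> class_C n (fun x => f x + g x).
Proof.
elim: n f g => [|n IHn] f g; first exact: continuous_add.
move=> [fd df] [gd dg]; split=> [x|v]; first exact: (differentiableD (fd x) (gd x)).
rewrite (_ : 'D_v _ = fun x => 'D_v f x + 'D_v g x); first exact: (IHn _ _ (df v) (dg v)).
by apply/funext => x; exact: (deriveD (diff_derivable (fd x)) (diff_derivable (gd x))).
Qed.

Lemma class_C_mul {R : realType} {V : normedModType R} n (f g : V -> R) :
  class_C n f -> class_C n g -> class_C n (fun x => f x * g x).
Proof.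
elim: n f g => [|n IHn] f g.
  by move=> fc gc x; apply: cvgM; [exact: fc|exact: gc].
move=> fC gC; have [[fd df] [gd dg]] := (fC, gC).
split=> [x|v]; first exact: (differentiableM (fd x) (gd x)).
rewrite (_ : 'D_v _ = fun x => f x * 'D_v g x + g x * 'D_v f x).
  by apply: class_C_add; apply: IHn;
    [exact: class_CW fC|exact: dg|exact: class_CW gC|exact: df].
by apply/funext => x; exact: (deriveM (diff_derivable (fd x)) (diff_derivable (gd x))).
Qed.

Lemma smooth_linear {R : realType} {V : normedModType R} (c : {linear V -> R}) :
  continuous c -> smooth c.
Proof.
move=> cc [//|n]; split=> [x|v]; first exact: linear_differentiable.
rewrite (_ : 'D_v _ = fun=> c v); first exact: class_C_cst.
by apply/funext => x; rewrite deriveE ?diff_lin//; exact: linear_differentiable.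
Qed.

(** * Hadamard's lemma *)

Lemma is_diff_homothety {R : realType} {V : normedModType R} (p x : V) (t : R) :
  is_diff x (fun y : V => p + t *: (y - p)) (fun v => t *: v).
Proof.
have -> : (fun y : V => p + t *: (y - p)) = cst p + t *: (id - cst p) by [].
by apply: is_diff_eq; apply/funext => v; rewrite add0r /= subr0.
Qed.

Lemma derive_homothety {R : realType} {V : normedModType R} (f : V -> R)
    (p x : V) (a t : R) :
  differentiable f (p + t *: (x - p)) ->
  differentiable (fun y => a * f (p + t *: (y - p))) x /\
  forall v, 'D_v (fun y => a * f (p + t *: (y - p))) x =
    a * t * 'D_v f (p + t *: (x - p)).
Proof.
move=> fd; have hd := is_diff_homothety p x t.
pose h (y : V) := p + t *: (y - p).
have fhd : differentiable (f \o h) x by exact: differentiable_comp.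
split=> [|v]; first by apply: (differentiableZ (f := f \o h)).
rewrite (deriveZ (f := f \o h)); last exact: diff_derivable.
rewrite deriveE// diff_comp//= deriveE// [X in 'd f _ (X v)]diff_val linearZ/=.
by rewrite -mulrA.
Qed.

(** The weight [t ^+ k] keeps the family closed under differentiation: each
    derivative in [x] brings out one factor [t]. *)
Definition radial_mean {R : realType} {V : normedModType R} (k : nat) (p : V)
    (f : V -> R) (x : V) : R :=
  int01 (fun t => t ^+ k * f (p + t *: (x - p))).

Lemma continuous_radial {R : realType} {V : normedModType R} (k : nat) (p : V)
    (f : V -> R) :
  continuous f -> continuous (fun z : R * V => z.1 ^+ k * f (p + z.1 *: (z.2 - p))).
Proof.
move=> fc z; apply: cvgM.
  apply: (@continuous_comp _ _ _ fst (fun t : R => t ^+ k)); last exact: exprn_continuous.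
  exact: cvg_fst.
apply: (@continuous_comp _ _ _ (fun z : R * V => p + z.1 *: (z.2 - p)) f); last exact: fc.
apply: cvgD; first exact: cvg_cst.
apply: cvgZ; first exact: cvg_fst.
by apply: cvgB; [exact: cvg_snd|exact: cvg_cst].
Qed.

Section finite_dimensional.
Context {R : realType} {V : normedModType R} {I : finType}.
Context (e : I -> V) (c : I -> {linear V -> R}).
Context (cc : forall i, continuous (c i))
  (ec : forall v, v = \sum_i c i v *: e i).

(** Induction on [n] with [k] generalized, since
    ['D_v (radial_mean k p f) = radial_mean k.+1 p ('D_v f)]. *)
Lemma class_C_radial_mean n k p (f : V -> R) :
  class_C n f -> class_C n (radial_mean k p f).
Proof.
elim: n k f => [|n IHn] k f fC.
  exact: (continuous_int01 (fun t x => t ^+ k * f (p + t *: (x - p)))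
    (continuous_radial k p f fC)).
have [fd dfC] := fC.
pose F t x := t ^+ k * f (p + t *: (x - p)).
have dF t x v : 'D_v (F t) x = t ^+ k.+1 * 'D_v f (p + t *: (x - p)).
  by rewrite (derive_homothety f p x _ t (fd _)).2 exprSr.
have FP : forall x, differentiable (radial_mean k p f) x /\
    forall v, 'D_v (radial_mean k p f) x = int01 (fun t => 'D_v (F t) x).
  apply: (leibniz_int01 e c cc ec F).
  - exact: (continuous_radial k p f (class_C_continuous _ _ fC)).
  - by move=> t x; exact: (derive_homothety f p x _ t (fd _)).1.
  - move=> v; rewrite (_ : (fun z => _) =
        fun z : R * V => z.1 ^+ k.+1 * 'D_v f (p + z.1 *: (z.2 - p))).
      exact: (continuous_radial k.+1 p _ (class_C_continuous _ _ (dfC v))).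
    by apply/funext => z; exact: dF.
split=> [x|v]; first exact: (FP x).1.
rewrite (_ : 'D_v _ = radial_mean k.+1 p ('D_v f)); first exact/IHn/dfC.
apply/funext => x; rewrite (FP x).2; congr int01; apply/funext => t.
exact: dF.
Qed.

(** The fundamental theorem of calculus along the segment from [p] to [x], where
    the derivative of [f (p + t *: (x - p))] is ['D_(x - p) f]; expanding [x - p]
    in the frame brings out the factors [c i (x - p)]. *)
Lemma hadamard (f : V -> R) (p : V) : smooth f ->
  exists2 g : I -> V -> R, (forall i, smooth (g i)) &
    forall x, f x = f p + \sum_i c i (x - p) * g i x.
Proof.
move=> fs; exists (fun i => radial_mean 0 p ('D_(e i) f)).
  by move=> i n; apply: class_C_radial_mean; exact: (fs n.+1).2.
move=> x.
have fd := (fs 1%N).1; have dfc v : continuous ('D_v f) := (fs 1%N).2 v.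
have lc v : continuous (fun t : R => 'D_v f (p + t *: (x - p))).
  move=> t; apply: (@continuous_comp _ _ _ (fun t : R => p + t *: (x - p)) ('D_v f));
    last exact: dfc.
  apply: cvgD; first exact: cvg_cst.
  by apply: cvgZ; [exact: cvg_id|exact: cvg_cst].
have := int01_derivative (fun t : R => f (p + t *: (x - p))) _ (lc (x - p))
  (fun t => is_derive_line _ _ _ _ (fd _)).
rewrite scale1r scale0r addr0 subrKC => /eqP; rewrite eq_sym subr_eq addrC => /eqP ->.
congr (_ + _).
have -> : (fun t => 'D_(x - p) f (p + t *: (x - p))) =
    fun t => \sum_i c i (x - p) * 'D_(e i) f (p + t *: (x - p)).
  by apply/funext => t; exact: derive_coord.
elim: (index_enum I) => [|i s IHs].
  under [X in int01 X]eq_fun do rewrite big_nil.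
  rewrite big_nil -[RHS](mul0r (int01 (cst 0))) -int01Z; last exact: cst_continuous.
  by congr int01; apply/funext => t; rewrite mul0r.
under [X in int01 X]eq_fun do rewrite big_cons.
have lci j : continuous
    (fun t : R => c j (x - p) * 'D_(e j) f (p + t *: (x - p))).
  by apply: continuous_cstM; exact: lc.
rewrite big_cons int01D; [|exact: lci|]; last first.
  apply: (@continuous_big _ _ _ _ _ _ _ s) => [|j _]; [exact: add_continuous|exact: lci].
rewrite IHs int01Z; last exact: lc.
by congr (_ * int01 _ + _); apply/funext => t; rewrite expr0 mul1r.
Qed.

End finite_dimensional.

(** * Smooth functions and derivations on the reduced space *)

Definition coordinate {R : realType} (s : 'I_3 + 'I_3) (v : 'cV[R]_3 * 'cV[R]_3) : R :=
  match s with inl i => v.1 i 0 | inr i => v.2 i 0 end.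

Lemma coordinate_is_linear {R : realType} s : linear (@coordinate R s).
Proof. by case: s => i a u v /=; rewrite !mxE. Qed.

HB.instance Definition _ (R : realType) (s : 'I_3 + 'I_3) :=
  GRing.isLinear.Build R ('cV[R]_3 * 'cV[R]_3)%type R *%R (@coordinate R s)
    (@coordinate_is_linear R s).

Definition unit_vector {R : realType} (s : 'I_3 + 'I_3) : 'cV[R]_3 * 'cV[R]_3 :=
  match s with inl i => (delta_mx i 0, 0) | inr i => (0, delta_mx i 0) end.

Lemma coordinate_continuous {R : realType} s : continuous (@coordinate R s).
Proof.
case: s => i v.
  apply: (@continuous_comp _ _ _ fst (fun A : 'cV[R]_3 => A i 0)); first exact: cvg_fst.
  exact: coord_continuous.
apply: (@continuous_comp _ _ _ snd (fun A : 'cV[R]_3 => A i 0)); first exact: cvg_snd.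
exact: coord_continuous.
Qed.

Lemma coordinate_expansion {R : realType} (v : 'cV[R]_3 * 'cV[R]_3) :
  v = \sum_s coordinate s v *: unit_vector s.
Proof.
have col_expansion (u : 'cV[R]_3) : u = \sum_i u i 0 *: delta_mx i 0.
  rewrite [LHS]matrix_sum_delta; apply: eq_bigr => i _.
  by rewrite big_ord_recl big_ord0 addr0.
have sum1 := big_morph fst (fun a b : 'cV[R]_3 * 'cV[R]_3 => erefl (a + b).1) erefl.
have sum2 := big_morph snd (fun a b : 'cV[R]_3 * 'cV[R]_3 => erefl (a + b).2) erefl.
rewrite [RHS]surjective_pairing sum1 sum2 !big_sumType/=.
under [X in (_ + X, _)]eq_bigr do rewrite scaler0.
under [X in (_, X + _)]eq_bigr do rewrite scaler0.
by rewrite !big1_eq addr0 add0r -!col_expansion -surjective_pairing.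
Qed.

Lemma smooth_red_add {R : realType} (F G : reduced_space R -> R) :
  smooth_red F -> smooth_red G -> smooth_red (fun p => F p + G p).
Proof.
move=> [f fs fE] [g gs gE]; exists (fun v => f v + g v) => [n|p].
  exact: class_C_add (fs n) (gs n).
by rewrite fE gE.
Qed.

Lemma smooth_red_mul {R : realType} (F G : reduced_space R -> R) :
  smooth_red F -> smooth_red G -> smooth_red (fun p => F p * G p).
Proof.
move=> [f fs fE] [g gs gE]; exists (fun v => f v * g v) => [n|p].
  exact: class_C_mul (fs n) (gs n).
by rewrite fE gE.
Qed.

Lemma smooth_red_cst {R : realType} (a : R) : smooth_red (fun=> a).
Proof. by exists (fun=> a) => // n; exact: class_C_cst. Qed.

Lemma smooth_red_sum {R : realType} {I : Type} (s : seq I) (F : I -> reduced_space R -> R) :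
  (forall i, smooth_red (F i)) -> smooth_red (fun p => \sum_(i <- s) F i p).
Proof.
move=> Fs; elim: s => [|i s IHs].
  by under eq_fun do rewrite big_nil; exact: smooth_red_cst.
by under eq_fun do rewrite big_cons; exact: smooth_red_add.
Qed.

Lemma smooth_red_coordinate {R : realType} s :
  smooth_red (fun p : reduced_space R => coordinate s (val p)).
Proof.
by exists (coordinate s) => //; apply: smooth_linear; exact: coordinate_continuous.
Qed.

Section point_derivation.
Context {R : realType}.
Context (p : reduced_space R) (D : (reduced_space R -> R) -> R).
Context (D_linear : forall (a b : R) F G, smooth_red F -> smooth_red G ->
  D (fun q => a * F q + b * G q) = a * D F + b * D G).
Context (D_leibniz : forall F G, smooth_red F -> smooth_red G ->
  D (fun q => F q * G q) = F p * D G + D F * G p).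

Lemma derivation_add F G : smooth_red F -> smooth_red G ->
  D (fun q => F q + G q) = D F + D G.
Proof.
move=> Fs Gs; rewrite -[D F]mul1r -[D G]mul1r -D_linear//.
by congr D; apply/funext => q; rewrite !mul1r.
Qed.

Lemma derivation_cst (a : R) : D (fun=> a) = 0.
Proof.
have s1 := @smooth_red_cst R 1.
have D1 : D (fun=> 1) = 0.
  have := D_leibniz _ _ s1 s1.
  rewrite (_ : (fun=> 1 * 1) = fun=> 1); last by apply/funext => q; rewrite mulr1.
  by rewrite mul1r mulr1 => /esym/eqP; rewrite -subr_eq0 addrK => /eqP.
have := D_linear a 0 _ _ s1 s1; rewrite D1 !mulr0 addr0 => <-.
by congr D; apply/funext => q; rewrite mul0r addr0 mulr1.
Qed.

Lemma derivation_sum {I : Type} (s : seq I) (F : I -> reduced_space R -> R) :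
  (forall i, smooth_red (F i)) ->
  D (fun q => \sum_(i <- s) F i q) = \sum_(i <- s) D (F i).
Proof.
move=> Fs; elim: s => [|i s IHs].
  by under [X in D X]eq_fun do rewrite big_nil; rewrite big_nil derivation_cst.
under [X in D X]eq_fun do rewrite big_cons.
by rewrite big_cons derivation_add ?IHs//; exact: smooth_red_sum.
Qed.

(** Only the values on the ambient coordinates of [R^3 x R^3] matter, since
    Hadamard's lemma can be applied to an ambient extension of [F]. *)
Lemma derivation_eq0 : (forall s, D (fun q => coordinate s (val q)) = 0) ->
  forall F, smooth_red F -> D F = 0.
Proof.
move=> D0 F [f fs fE].
have [g gs gE] := hadamard unit_vector coordinate (@coordinate_continuous R)
  (@coordinate_expansion R) f (val p) fs.
have cs s : smooth_red (fun q => coordinate s (val q) + - coordinate s (val p)).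
  by apply: smooth_red_add; [exact: smooth_red_coordinate|exact: smooth_red_cst].
have rs s : smooth_red (fun q => g s (val q)) by exists (g s).
have -> : F = fun q => f (val p) +
    \sum_s (coordinate s (val q) + - coordinate s (val p)) * g s (val q).
  apply/funext => q; rewrite fE gE; congr (_ + _); apply: eq_bigr => s _.
  by rewrite linearB.
rewrite derivation_add; [|exact: smooth_red_cst|]; last first.
  by apply: smooth_red_sum => s; exact: smooth_red_mul.
rewrite derivation_cst add0r derivation_sum; last by move=> s; exact: smooth_red_mul.
apply: big1 => s _; rewrite D_leibniz// subrr mul0r add0r.
rewrite derivation_add; [|exact: smooth_red_coordinate|exact: smooth_red_cst].
by rewrite D0 derivation_cst addr0 mul0r.
Qed.

End point_derivation.

(** * Brackets with the vertical angular momentum *)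

Lemma levi_civitaCr {R : realType} (i j l : 'I_3) :
  levi_civita R i l j = - levi_civita R i j l.
Proof. by rewrite /levi_civita; ring. Qed.

Lemma levi_civitaCl {R : realType} (i j l : 'I_3) :
  levi_civita R j i l = - levi_civita R i j l.
Proof. by rewrite /levi_civita; ring. Qed.

Lemma levi_civita_sum_sym {R : realType} (i : 'I_3) (S : 'I_3 -> 'I_3 -> R) :
  (forall j l, S l j = S j l) -> \sum_j \sum_l levi_civita R i j l * S j l = 0.
Proof.
move=> SC; set s := LHS.
have : s = - s.
  rewrite {1}/s exchange_big/= -sumrN; apply: eq_bigr => j _.
  by rewrite -sumrN; apply: eq_bigr => l _; rewrite levi_civitaCr SC mulNr.
lra.
Qed.

Theorem theorem6p11 (R : realType) (I : 'rV[R]_3) (m r : R)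
    (hI : forall i, 0 < I 0 i) (hm : 0 < m) (hr : 0 < r)
    (br : (reduced_space R -> R) -> (reduced_space R -> R) -> reduced_space R -> R)
    (hbr : is_reduced_affine_bracket I m r br) :
  is_casimir br (@K3s R).
Proof.
have [[_ brl _ brC brM] brKK brKg brgg] := hbr.
have Ks i : smooth_red (@Kb R i) := smooth_red_coordinate (inl i).
have gs i : smooth_red (@gam R i) := smooth_red_coordinate (inr i).
have KgS i : smooth_red (fun q => @Kb R i q * gam i q) by exact: smooth_red_mul.
have K3E : @K3s R = fun p => \sum_i Kb i p * gam i p by [].
have K3S : smooth_red (@K3s R) by rewrite K3E; exact: smooth_red_sum.
split=> // F Fs p.
have lin G (Gs : smooth_red G) a b F1 F2 F1s F2s := brl a b F1 F2 G F1s F2s Gs p.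
have leib G (Gs : smooth_red G) F1 F2 F1s F2s := brM F1 F2 G F1s F2s Gs p.
have brK3 G : smooth_red G -> br G (@K3s R) p =
    \sum_j (Kb j p * br G (gam j) p + br G (Kb j) p * gam j p).
  move=> Gs; rewrite brC// K3E.
  have -> := derivation_sum p (fun F => br F G p) (lin G Gs) (leib G Gs)
    (index_enum _) _ KgS.
  rewrite -sumrN; apply: eq_bigr => j _.
  by rewrite brM// (brC (gam j))// (brC (Kb j))//; ring.
have brKK3 i : br (Kb i) (@K3s R) p = 0.
  rewrite (brK3 _ (Ks i)) -[RHS]oppr0.
  (* The first two terms come from the two factors of K3s; each alone is not
     symmetric in j and l, only their sum is. *)
  rewrite -[in RHS](levi_civita_sum_sym i (fun j l => Kb j p * gam l p +
    Kb l p * gam j p - m * r ^+ 2 * omega3s I m r p * gam j p * gam l p)); last first.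
    by move=> j l; ring.
  rewrite -sumrN; apply: eq_bigr => j _.
  rewrite brKK brKg mulrN mulNr -opprD; congr (- _).
  by rewrite mulr_sumr mulr_suml -big_split; apply: eq_bigr => l _ /=; ring.
have brgK3 i : br (gam i) (@K3s R) p = 0.
  rewrite (brK3 _ (gs i)).
  rewrite -[RHS](levi_civita_sum_sym i (fun j l => - (gam j p * gam l p))); last first.
    by move=> j l; ring.
  apply: eq_bigr => j _; rewrite brgg brC// brKg mulr0 add0r opprK mulr_suml.
  by apply: eq_bigr => l _; rewrite levi_civitaCl; ring.
apply: (derivation_eq0 p (fun F => br F (@K3s R) p) (lin _ K3S) (leib _ K3S)) F Fs.
by case=> i; [exact: brKK3|exact: brgK3].
Qed.
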